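(* Let $(X_n)$ be generated by the $\lambda$-SAGA algorithm (defined in the context) with a fixed $\lambda\in[0,1]$ and a positive deterministic step sequence $(\gamma_n)$ decreasing to $0$ with $\sum_{n\ge1}\gamma_n=+\infty$ and $\sum_{n\ge1}\gamma_n^2<+\infty$. Assume: (A1) $f$ is continuously differentiable and there is a unique $x^*\in\mathbb R^d$ with $\nabla f(x^* )=0$; (A2) for all $x\neq x^*$, $\langle x-x^*,\nabla f(x)\rangle>0$; (A3) there is $L>0$ such that for all $x\in\mathbb R^d$, $\frac1N\sum_{k=1}^N\|\nabla f_k(x)-\nabla f_k(x^* )\|^2\le L\|x-x^*\|^2$. Then $\lim_{n\to\infty}X_n=x^*$ almost surely and $\lim_{n\to\infty}f(X_n)=f(x^* )$ almost surely.
   Context: Let $N,d\ge1$ be integers, $f_1,\dots,f_N:\mathbb R^d\to\mathbb R$ differentiable, and $f=\frac1N\sum_{k=1}^N f_k$. The $\lambda$-SAGA algorithm with parameter $\lambda\in[0,1]$ and positive deterministic steps $(\gamma_n)_{n\ge1}$: let $X_0,X_1$ be square-integrable random vectors in $\mathbb R^d$ and $(U_n)_{n\ge2}$ i.i.d. uniform on $\{1,\dots,N\}$, independent of $(X_0,X_1)$. Set $g_{1,k}=\nabla f_k(X_0)$ for $k=1,\dots,N$ and for $n\ge1$: $X_{n+1}=X_n-\gamma_n\Big(\nabla f_{U_{n+1}}(X_n)-\lambda\big(g_{n,U_{n+1}}-\frac1N\sum_{k=1}^N g_{n,k}\big)\Big)$, and $g_{n+1,k}=\nabla f_k(X_n)$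 if $U_{n+1}=k$, $g_{n+1,k}=g_{n,k}$ otherwise. *)

(* Defs.v *)
From HB Require Import structures.
From mathcomp Require Import all_boot all_order all_algebra.
From mathcomp Require Import all_classical all_reals all_analysis.
Set Implicit Arguments. Unset Strict Implicit. Unset Printing Implicit Defensive.
Import Order.TTheory GRing.Theory Num.Theory.
Import numFieldNormedType.Exports.
Local Open Scope classical_set_scope.
Local Open Scope ring_scope.

(* Vectors of R^d are row vectors 'rV[R]_d (normed by mathcomp-analysis' max
   norm, which induces the usual topology of R^d). *)

Definition dotv {R : realType} {d : nat} (x y : 'rV[R]_d) : R :=
  \sum_(i < d) x ord0 i * y ord0 i.
Definition sqnorm {R : realType} {d : nat} (x : 'rV[R]_d) : R := dotv x x.

Definition grad {R : realType} {d : nat} (h : 'rV[R]_d -> R) (x : 'rV[R]_d)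
  : 'rV[R]_d := \row_(i < d) derive h x (delta_mx ord0 i).

Definition favg {R : realType} {d N : nat} (fk : 'I_N -> 'rV[R]_d -> R)
  (x : 'rV[R]_d) : R := N%:R^-1 * \sum_(k < N) fk k x.

(* lambda-SAGA, pathwise.  saga_state m = (X_{m+1}, g_{m+1}) for m >= 0,
   with g_{1,k} = grad f_k (X_0) and, for n = m+1,
   X_{n+1} = X_n - gamma_n (grad f_{U_{n+1}}(X_n)
                   - lambda (g_{n,U_{n+1}} - 1/N sum_k g_{n,k})),
   g_{n+1,k} = grad f_k (X_n) if U_{n+1} = k, g_{n,k} otherwise.
   Indices 1..N are represented by 'I_N = {0,..,N-1}. *)
Fixpoint saga_state {R : realType} {d N : nat} (fk : 'I_N -> 'rV[R]_d -> R)
  (lam : R) (gam : nat -> R) (x0 x1 : 'rV[R]_d) (u : nat -> 'I_N) (m : nat)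
  : 'rV[R]_d * ('I_N -> 'rV[R]_d) :=
  match m with
  | 0 => (x1, fun k => grad (fk k) x0)
  | m'.+1 =>
      let st := saga_state fk lam gam x0 x1 u m' in
      let x := st.1 in
      let g := st.2 in
      let n := m'.+1 in
      let U := u n.+1 in
      (x - gam n *: (grad (fk U) x
                     - lam *: (g U - N%:R^-1 *: \sum_(k < N) g k)),
       fun k => if k == U then grad (fk k) x else g k)
  end.

Definition saga_iter {R : realType} {d N : nat} (fk : 'I_N -> 'rV[R]_d -> R)
  (lam : R) (gam : nat -> R) (x0 x1 : 'rV[R]_d) (u : nat -> 'I_N) (n : nat)
  : 'rV[R]_d :=
  match n with
  | 0 => x0
  | n'.+1 => (saga_state fk lam gam x0 x1 u n').1
  end.

(* sigma(Y_1, Y_2) for two random vectors: generated by the coordinate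
   preimages of Borel sets (Borel(R^d) is the product of the Borel(R)). *)
Definition sigma_pair {R : realType} {d0 : measure_display}
  {Omega : measurableType d0} {d : nat} (Y Z : Omega -> 'rV[R]_d)
  : set (set Omega) :=
  <<s [set A | exists i : 'I_d, exists B : set R, measurable B /\
        (A = (fun w => Y w ord0 i) @^-1` B \/ A = (fun w => Z w ord0 i) @^-1` B)] >>.

(* Mutual independence of the sigma-algebra sigma(X_0, X_1) and of the
   sigma-algebras sigma(U_n), n >= 2 (U_n valued in a finite set with its
   discrete sigma-algebra): product rule over every finite subfamily. *)
Definition saga_indep {R : realType} {d0 : measure_display}
  {Omega : measurableType d0} (P : probability Omega R) {d N : nat}
  (X0 X1 : Omega -> 'rV[R]_d) (U : nat -> Omega -> 'I_N) : Prop :=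
  forall (A : set Omega) (s : seq nat) (S : nat -> {set 'I_N}),
    sigma_pair X0 X1 A -> uniq s -> all (fun n => 2 <= n)%N s ->
    P (A `&` \bigcap_(n in [set n | n \in s]) [set w | U n w \in S n]) =
    (P A * \prod_(n <- s) P [set w | U n w \in S n])%E.

(* Main.v *)
Require Import Defs.
From HB Require Import structures.
From mathcomp Require Import all_boot all_order all_algebra.
From mathcomp Require Import all_classical all_reals all_analysis.
From mathcomp Require Import measurable_realfun zify ring lra.
Import Order.TTheory GRing.Theory Num.Theory.
Import numFieldNormedType.Exports.
Local Open Scope classical_set_scope.
Local Open Scope ring_scope.
Set Implicit Arguments. Unset Strict Implicit. Unset Printing Implicit Defensive.

(* A Robbins-Siegmund argument in which no conditional expectation occurs.
   Write xs for the minimizer, A_n for the mean over k of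
   |g_{n,k} - grad f_k(xs)|^2, and R_n for the tail sum of gam_j^2.  For
   suitable a and b,
     Z_n = exp(a R_n) (|X_n - xs|^2 + 6 N gam_n^2 A_n + b R_n)
   satisfies E[Z_{n+1} | past] <= Z_n - drift_n with
     drift_n = 2 gam_n <X_n - xs, grad f(X_n)> + 3 gam_n^2 A_n >= 0.
   For fixed (X_0, X_1) the algorithm runs on the N-ary tree of draws, so the
   maximal inequality for nonnegative supermartingales is an inequality between
   finite sums over words; independence and uniformity of the draws carry it
   over to P.  Applied to Z_n + sum_{j<n} drift_j it bounds this process almost
   surely, which forces liminf Z_n = 0: if Z_n stayed away from 0, the iterates
   would eventually stay in a compact annulus around xs on which the scalar
   product is bounded below, contradicting sum gam_n = +oo.  Applied to Z
   restarted when it first drops below eps, it shows that Z then reaches c with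
   probability at most eps/c, so liminf Z_n = 0 implies Z_n -> 0. *)

(** * Supermartingales on the tree of words *)

Fixpoint words (K : finType) (m : nat) : seq (seq K) :=
  if m is m'.+1 then [seq k :: h | h <- words K m', k <- enum K] else [:: [::]].

Lemma size_words (K : finType) m (h : seq K) : h \in words K m -> size h = m.
Proof.
elim: m h => [|m IH] h /=; first by rewrite inE => /eqP ->.
by move=> /allpairsPdep[h' [k [/IH hh' _ ->]]] /=; rewrite hh'.
Qed.

Lemma mem_words (K : finType) (h : seq K) : h \in words K (size h).
Proof.
elim: h => [|k h IH] /=; first by rewrite inE.
by apply/allpairsPdep; exists h, k; rewrite mem_enum.
Qed.

(* Words list the most recent draw first: the suffixes of [h] are its past. *)
Fixpoint ever (K : Type) (p : pred (seq K)) (h : seq K) : bool :=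
  p h || (if h is _ :: h' then ever p h' else false).

Lemma sum_words (V : nmodType) (K : finType) (F : seq K -> V) (m : nat) :
  \sum_(h <- words K m.+1) F h = \sum_(h <- words K m) \sum_k F (k :: h).
Proof.
rewrite /= big_allpairs_dep /=.
by apply: eq_bigr => h _; rewrite big_enum.
Qed.

(** Optional stopping on the tree: a frozen word passes exactly [c] to each child, an unfrozen one
    obeys the supermartingale inequality, and freezing a child that has just reached [c] can only
    lower its value. *)
Lemma sum_stopped (R : realType) (K : finType) (W : seq K -> R) (c : R) (m : nat) :
  (forall h, \sum_k W (k :: h) <= #|K|%:R * W h) ->
  \sum_(h <- words K m) (if ever (fun h => c <= W h) h then c else W h)
    <= #|K|%:R ^+ m * W [::].
Proof.
move=> superW; elim: m => [|m IH].
  rewrite [words _ _]/= big_seq1 expr0 mul1r /= orbF; case: ifP => //.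
rewrite sum_words exprS -mulrA; apply: le_trans (ler_wpM2l (ler0n _ _) IH).
rewrite mulr_sumr; apply: ler_sum => h _ /=.
case: ifP => hh.
  under eq_bigr do rewrite orbT.
  by rewrite sumr_const mulr_natl.
apply: le_trans (superW h); apply: ler_sum => k _.
by rewrite orbF; case: ifP.
Qed.

(** Markov's inequality for the stopped process. Divided by [#|K| ^ m] it is the maximal inequality
    at horizon [m] for uniform draws. *)
Lemma count_hits (R : realType) (K : finType) (W : seq K -> R) (c : R) (m : nat) :
  (forall h, 0 <= W h) -> 0 <= c ->
  (forall h, \sum_k W (k :: h) <= #|K|%:R * W h) ->
  c * \sum_(h <- words K m) (ever (fun h => c <= W h) h)%:R <= #|K|%:R ^+ m * W [::].
Proof.
move=> W0 c0 superW; apply: le_trans (@sum_stopped R K W c m superW).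
rewrite mulr_sumr; apply: ler_sum => h _.
by case: ifP; rewrite ?mulr1 ?mulr0.
Qed.

(** A predictable sum: only proper suffixes of the word enter, so all children of a word share the
    same value. *)
Fixpoint past_sum (V : nmodType) (K : Type) (f : seq K -> V) (h : seq K) : V :=
  if h is _ :: h' then past_sum f h' + f h' else 0.

Lemma past_sum_ge0 (R : realType) (K : Type) (f : seq K -> R) (h : seq K) :
  (forall h, 0 <= f h) -> 0 <= past_sum f h.
Proof. by move=> f0; elim: h => //= k h IH; rewrite addr_ge0. Qed.

Lemma compensated_supermartingale (R : realType) (K : finType) (Z f : seq K -> R) :
  (forall h, \sum_k Z (k :: h) <= #|K|%:R * (Z h - f h)) ->
  forall h, \sum_k (Z (k :: h) + past_sum f (k :: h)) <=
            #|K|%:R * (Z h + past_sum f h).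
Proof.
move=> superZ h; rewrite big_split /= sumr_const -[X in _ + X]mulr_natl.
by have := superZ h; rewrite mulrBr !mulrDr; lra.
Qed.

(** The switch from the constant [a] to [Z] happens where [Z < a], so it only lowers the value. *)
Lemma restarted_supermartingale (R : realType) (K : finType) (Z : seq K -> R) (a : R) :
  (forall h, \sum_k Z (k :: h) <= #|K|%:R * Z h) ->
  let W h := if ever (fun h => Z h < a) h then Z h else a in
  forall h, \sum_k W (k :: h) <= #|K|%:R * W h.
Proof.
move=> superZ W h; rewrite /W.
case: ifPn => hh; first by under eq_bigr do rewrite /= hh orbT; exact: superZ.
rewrite mulr_natl -sumr_const; apply: ler_sum => k _ /=.
by rewrite (negbTE hh) orbF; case: ifP => // /ltW.
Qed.

(** * Measurability for random vectors *)

Lemma rV_norm_ltP (R : realType) (d : nat) (x : 'rV[R]_d) (e : R) : 0 < e ->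
  (`|x| < e) <-> (forall i, `|x ord0 i| < e).
Proof.
move=> e0; rewrite /Num.Def.normr /= mx_normrE; split.
  move=> /bigmax_ltP [_ H] i; exact: (H (ord0, i)).
move=> H; apply: bigmax_lt => // -[i j] _ /=.
by rewrite (ord1 i); exact: H.
Qed.

(** An open set is a countable union of max-norm balls with rational centres, and such a ball is a
    finite product of intervals. *)
Lemma measurable_preimage_open (R : realType) (d0 : measure_display)
    (T : measurableType d0) (d : nat) (Y : T -> 'rV[R]_d) (O : set 'rV[R]_d) :
  (forall i, measurable_fun setT (fun w => Y w ord0 i)) ->
  open O -> measurable (Y @^-1` O).
Proof.
move=> mY oO.
pose q (u : nat * {ffun 'I_d -> int}) : 'rV[R]_d :=
  \row_i ((u.2 i)%:~R / u.1.+1%:R).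
pose F u := if `[< ball (q u) (2 / u.1.+1%:R) `<=` O >]
  then Y @^-1` (ball (q u) (2 / u.1.+1%:R)) else set0.
have -> : Y @^-1` O = \bigcup_u F u.
  apply/seteqP; split => [w Ow|w [u _]]; last first.
    by rewrite /F; case: asboolP => // sub /sub.
  have /nbhs_ballP [e /= e0 sub] := open_nbhs_nbhs (conj oO Ow : open_nbhs (Y w) O).
  (* Rounding down moves each coordinate by less than [1/(n+1)], so the ball of radius [2/(n+1)]
     around the rounded point contains [Y w], and all its points lie within [4/(n+1)] of [Y w]. *)
  have [n] : exists n : nat, 4 / n.+1%:R < e.
    exists (Num.truncn (4 / e)).
    by rewrite ltr_pdivrMr// mulrC -ltr_pdivrMr// truncnS_gt.
  move=> ne.
  pose z : {ffun 'I_d -> int} := [ffun i => Num.floor (n.+1%:R * Y w ord0 i)].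
  have n0 : 0 < n.+1%:R :> R by rewrite ltr0n.
  have close : ball (q (n, z)) (2 / n.+1%:R) (Y w).
    rewrite -ball_normE /=; apply/rV_norm_ltP; first by rewrite divr_gt0.
    move=> i; rewrite !mxE /= ffunE.
    have := floor_itv (n.+1%:R * Y w ord0 i).
    set z0 : R := (Num.floor _)%:~R; rewrite intrD -/z0 mulr1z => /andP[h1 h2].
    have -> : z0 / n.+1%:R - Y w ord0 i = (z0 - n.+1%:R * Y w ord0 i) / n.+1%:R.
      by field; rewrite lt0r_neq0// addrC natr1.
    rewrite normrM (gtr0_norm (_ : 0 < n.+1%:R^-1)) ?invr_gt0//.
    rewrite ltr_pM2r ?invr_gt0// ltr_norml; 
    by apply/andP; split; lra.
  exists (n, z) => //; rewrite /F; case: asboolP => // -[] y hy.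
  apply: sub; apply: le_ball (ltW ne) _ _.
  have -> : 4 / n.+1%:R = 2 / n.+1%:R + 2 / n.+1%:R :> R by rewrite -mulrDl -natrD.
  apply: ball_triangle hy; exact: ball_sym.
apply: countable_bigcupT_measurable => [|u]; first exact: countableP.
rewrite /F; case: asboolP => // _.
have r0 : 0 < 2 / u.1.+1%:R :> R by rewrite divr_gt0// ltr0n.
have -> : Y @^-1` (ball (q u) (2 / u.1.+1%:R)) =
    \bigcap_(i in [set: 'I_d]) (fun w => Y w ord0 i) @^-1`
      `](q u ord0 i - 2 / u.1.+1%:R), (q u ord0 i + 2 / u.1.+1%:R)[%classic.
  rewrite -ball_normE; apply/seteqP; split => w /=.
    move=> /(rV_norm_ltP _ r0) H i _ /=; rewrite in_itv /=.
    by have := H i; rewrite !mxE distrC ltr_distl.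
  move=> H; apply/(rV_norm_ltP _ r0) => i.
  by have := H i I; rewrite /= in_itv /= !mxE distrC ltr_distl.
apply: fin_bigcap_measurable => // i _; rewrite -[X in measurable X]setTI.
by apply: mY => //; exact: measurable_itv.
Qed.

Lemma continuous_measurable_comp (R : realType) (d0 : measure_display)
    (T : measurableType d0) (d : nat) (Y : T -> 'rV[R]_d) (f : 'rV[R]_d -> R) :
  (forall i, measurable_fun setT (fun w => Y w ord0 i)) ->
  continuous f -> measurable_fun setT (f \o Y).
Proof.
move=> mY cf; apply: (measurability _ (RGenOpens.measurableE R)).
move=> _ [_ [a [b ->] <-]]; rewrite setTI comp_preimage.
apply: measurable_preimage_open => //.
by move/continuousP : cf; apply; exact: interval_open.
Qed.

(** The gradient of a differentiable function may be discontinuous; each partial derivative is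
    nevertheless a pointwise limit of difference quotients with increments [1/(n+1)], which are
    continuous. *)
Lemma grad_measurable_comp (R : realType) (d0 : measure_display)
    (T : measurableType d0) (d : nat) (Y : T -> 'rV[R]_d) (f : 'rV[R]_d -> R) i :
  (forall i, measurable_fun setT (fun w => Y w ord0 i)) ->
  (forall x, differentiable f x) -> measurable_fun setT (fun w => grad f (Y w) ord0 i).
Proof.
move=> mY df.
have cf : continuous f by move=> x; apply: differentiable_continuous.
pose v : 'rV[R]_d := delta_mx ord0 i.
pose h (n : nat) (w : T) : R :=
  n.+1%:R * (f (n.+1%:R^-1 *: v + Y w) - f (Y w)).
apply: (@measurable_fun_cvg _ _ _ _ h).
  move=> n; apply: measurable_funM => //; apply: measurable_funB; last first.
    exact: continuous_measurable_comp.
  apply: (@continuous_measurable_comp _ _ _ _ (fun w => n.+1%:R^-1 *: v + Y w)) => // j.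
  under eq_fun do rewrite mxE.
  exact: measurable_funD.
move=> w _; rewrite mxE.
have /cvg_ex [l hl] : derivable f (Y w) v by apply: diff_derivable.
have -> : derive f (Y w) v = l by apply/cvg_lim.
have /cvgr_dnbhsP := hl.
have harm : (forall n : nat, n.+1%:R^-1 != 0 :> R) /\
    (fun n : nat => n.+1%:R^-1 : R) @ \oo --> (0 : R).
  by split=> [n|]; [rewrite invr_neq0 | exact: cvg_harmonic].
move=> /(_ _ harm).
apply: cvg_trans; apply: near_eq_cvg; near=> n.
by rewrite /h /= invrK.
Unshelve. all: by end_near.
Qed.

(** * From counting words to probabilities *)

(* [:: U_{m+1}; ...; U_2] *)
Fixpoint history (K T : Type) (U : nat -> T -> K) (m : nat) (w : T) : seq K :=
  if m is m'.+1 then U m'.+2 w :: history U m' w else [::].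

Lemma size_history (K T : Type) (U : nat -> T -> K) m w :
  size (history U m w) = m.
Proof. by elim: m => //= m ->. Qed.

Lemma nth_history (K T : Type) (U : nat -> T -> K) k0 m w j :
  (j < m)%N -> nth k0 (history U m w) j = U (m.+1 - j)%N w.
Proof.
elim: m j => // m IH [_|j]; first by rewrite subn0.
by rewrite ltnS => jm; rewrite /= IH// subSS.
Qed.

Section conditional_counting.
Context (R : realType) (d0 : measure_display) (Omega : measurableType d0).
Variables (P : probability Omega R) (K : finType) (U : nat -> Omega -> K).

(** In the application [<<s G >>] is the sigma-algebra of the initial vectors, on which functions of
    words depend through the parameter [w]. *)
Variable G : set (set Omega).
Hypothesis G_measurable : <<s G >> `<=` measurable.
Hypothesis K_gt0 : (0 < #|K|)%N.
Hypothesis U_measurable : forall n (S : {set K}), measurable [set w | U n w \in S].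
Hypothesis U_uniform : forall n k, (2 <= n)%N ->
  P [set w | U n w = k] = (#|K|%:R^-1)%:E.
Hypothesis U_indep : forall (A : set Omega) (s : seq nat) (S : nat -> {set K}),
  <<s G >> A -> uniq s -> all (fun n => 2 <= n)%N s ->
  P (A `&` \bigcap_(n in [set n | n \in s]) [set w | U n w \in S n]) =
  (P A * \prod_(n <- s) P [set w | U n w \in S n])%E.

Lemma history_measurable m h : measurable [set w | history U m w = h].
Proof.
elim: m h => [|m IH] [|k h] /=.
- by rewrite [X in measurable X](_ : _ = setT)//; apply/seteqP; split.
- by rewrite [X in measurable X](_ : _ = set0)//; apply/seteqP; split.
- by rewrite [X in measurable X](_ : _ = set0)//; apply/seteqP; split.
rewrite [X in measurable X](_ : _ =
  [set w | U m.+2 w \in [set k]%SET] `&` [set w | history U m w = h]); last first.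
  apply/seteqP; split => w /=; rewrite finset.in_set1.
    by case=> -> ->; rewrite eqxx.
  by case=> /eqP -> ->.
exact: measurableI.
Qed.

Lemma history_indep m (A : set Omega) h : <<s G >> A -> size h = m ->
  P (A `&` [set w | history U m w = h]) = (P A * (#|K|%:R^-1 ^+ m)%:E)%E.
Proof.
move=> GA hm.
have /card_gt0P[k0 _] := K_gt0.
(* Entry [j] of the history is the draw of index [m+1-j]; conversely draw [n] must equal entry
   [m+1-n] of [h]. *)
pose S n : {set K} := [set nth k0 h (m.+1 - n)]%SET.
have <- : \bigcap_(n in [set n | n \in iota 2 m]) [set w | U n w \in S n] =
    [set w | history U m w = h].
  apply/seteqP; split => w /=; last first.
    move=> hw n; rewrite /= mem_iota => /andP[n2 nm].
    rewrite finset.in_set1 -hw nth_history; last lia.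
    by rewrite subKn//; lia.
  move=> H; apply: (@eq_from_nth _ k0); rewrite size_history ?hm// => j jm.
  rewrite nth_history//; have := H (m.+1 - j)%N.
  rewrite /= mem_iota finset.in_set1 subKn; last by lia.
  by move=> H'; apply/eqP/H'; lia.
rewrite U_indep ?iota_uniq//; last by apply/allP => n; rewrite mem_iota => /andP[].
congr (_ * _)%E.
rewrite (eq_big_seq (fun=> (#|K|%:R^-1)%:E)); last first.
  move=> n; rewrite mem_iota => /andP[n2 _].
  rewrite -(U_uniform (nth k0 h (m.+1 - n)) n2); congr (P _).
  by apply/seteqP; split => w /=; rewrite finset.in_set1 => /eqP.
rewrite prodEFin big_const_seq count_predT size_iota.
by rewrite iter_mulr_1.
Qed.

(** The event splits over the values [h] of the history. Independence gives each piece the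
    probability [P (B h) / #|K| ^ m], and the sum of the [P (B h)] is the expected number of words
    [h] with [w] in [B h], hence at most [c]. *)
Lemma prob_history_le m (B : seq K -> set Omega) (c : R) :
  (forall h, <<s G >> (B h)) ->
  (forall w, \sum_(h <- words K m) \1_(B h) w <= c) ->
  measurable [set w | B (history U m w) w] /\
  (P [set w | B (history U m w) w] <= (c * #|K|%:R^-1 ^+ m)%:E)%E.
Proof.
move=> GB Bc.
have mB h : measurable (B h) by exact: G_measurable.
pose F h := B h `&` [set w | history U m w = h].
have E : [set w | B (history U m w) w] = \big[setU/set0]_(h <- words K m) F h.
  rewrite -bigcup_seq; apply/seteqP; split => [w Bw|w [h _] [+ hw]].
    exists (history U m w) => //=.
    by rewrite -[in X in words K X](size_history U m w) mem_words.
  by rewrite /= hw.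
have mF h : measurable (F h) by apply: measurableI => //; exact: history_measurable.
split; first by rewrite E; apply: bigsetU_measurable.
have : (P [set w | B (history U m w) w] <= \sum_(h <- words K m) P (F h))%E.
  rewrite E; elim: (words K m) => [|h s IH]; first by rewrite !big_nil measure0.
  rewrite !big_cons; apply: le_trans (leeD2l _ IH).
  by apply: measureU2 => //; apply: bigsetU_measurable.
move=> /le_trans; apply.
rewrite (eq_big_seq (fun h => P (B h) * (#|K|%:R^-1 ^+ m)%:E)%E); last first.
  by move=> h /size_words hm; rewrite /F history_indep.
rewrite -ge0_sume_distrl; last by move=> h _; exact: measure_ge0.
rewrite EFinM; apply: lee_wpmul2r; first by rewrite lee_fin exprn_ge0.
rewrite (eq_bigr (fun h => \int[P]_w (\1_(B h) w)%:E)%E); last first.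
  by move=> h _; rewrite integral_indic// setIT.
rewrite -ge0_integral_sum//; last first.
  by move=> h; apply/measurable_EFinP; exact: measurable_indic.
apply: (@le_trans _ _ (\int[P]_w (cst c%:E w))%E).
  apply: ge0_le_integral => //.
  - by move=> w _; rewrite sumEFin lee_fin; apply: sumr_ge0 => h _; rewrite ler0n.
  - under eq_fun do rewrite sumEFin.
    by apply/measurable_EFinP; apply: measurable_sum => h; exact: measurable_indic.
  - by move=> w _; rewrite sumEFin lee_fin; exact: Bc.
by rewrite integral_cst// [X in (_ * X)%E](probability_setT P) mule1.
Qed.

Lemma ever_history (p : pred (seq K)) m w :
  ever p (history U m w) <-> exists2 j, (j <= m)%N & p (history U j w).
Proof.
elim: m => [|m IH] /=.
  rewrite orbF; split=> [h|[j]]; first by exists 0%N.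
  by rewrite leqn0 => /eqP ->.
split=> [/orP[h|/IH[j jm h]]|[j]].
- by exists m.+1.
- by exists j => //; rewrite leqW.
- rewrite leq_eqVlt => /orP[/eqP ->|jm] h; first by rewrite h.
  by apply/orP; right; apply/IH; exists j.
Qed.

Lemma ever_measurable (p : Omega -> pred (seq K)) h :
  (forall h, <<s G >> [set w | p w h]) -> <<s G >> [set w | ever (p w) h].
Proof.
move=> mp; elim: h => [|k h IH] /=.
  by under eq_set do rewrite orbF; exact: mp.
rewrite [X in <<s _ >> X](_ : _ = [set w | p w (k :: h)] `|` [set w | ever (p w) h]).
  by apply: (@measurableU _ (g_sigma_algebraType G)) => //; exact: mp.
by apply/seteqP; split=> w /= => [/orP[]|[->//|->]]; [left|right|rewrite orbT].
Qed.

Lemma le_sigma (W : Omega -> seq K -> R) c h :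
  measurable_fun setT (W ^~ h : g_sigma_algebraType G -> R) ->
  <<s G >> [set w | c <= W w h].
Proof.
move=> mW; have := @measurable_fun_le _ (g_sigma_algebraType G) R setT (cst c) (W ^~ h).
by rewrite setTI; apply.
Qed.

Lemma lt_sigma (W : Omega -> seq K -> R) c h :
  measurable_fun setT (W ^~ h : g_sigma_algebraType G -> R) ->
  <<s G >> [set w | W w h < c].
Proof.
move=> mW; rewrite (_ : mkset _ = ~` [set w | c <= W w h]).
  exact: (@measurableC _ (g_sigma_algebraType G) _ (le_sigma c mW)).
by apply/seteqP; split=> w /=; rewrite ltNge => /negP.
Qed.

(** For each [w] in [A], [count_hits] bounds the number of words of length [m] that reach [c];
    continuity from below then removes the horizon. The event [A] serves to localize where the
    initial value is bounded. *)
Lemma maximal_inequality (A : set Omega) (W : Omega -> seq K -> R) (c w0 : R) :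
  0 < c -> <<s G >> A ->
  (forall h, measurable_fun setT (W ^~ h : g_sigma_algebraType G -> R)) ->
  (forall w h, 0 <= W w h) ->
  (forall w h, \sum_k W w (k :: h) <= #|K|%:R * W w h) ->
  (forall w, A w -> W w [::] <= w0) -> 0 <= w0 ->
  let E := [set w | A w /\ exists m, c <= W w (history U m w)] in
  measurable E /\ (P E <= (w0 / c)%:E)%E.
Proof.
move=> c0 GA mW W0 superW Ww0 w00 E.
have K0 : 0 < #|K|%:R :> R by rewrite ltr0n.
pose B h := A `&` [set w | ever (fun h => c <= W w h) h].
pose F m := [set w | B (history U m w) w].
have GB h : <<s G >> (B h).
  apply: (@measurableI _ (g_sigma_algebraType G)) => //.
  by apply: ever_measurable => h'; exact: le_sigma.
have PF m : measurable (F m) /\ (P (F m) <= (w0 / c)%:E)%E.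
  have -> : w0 / c = (#|K|%:R ^+ m * w0 / c) * #|K|%:R^-1 ^+ m.
    by rewrite exprVn; field; rewrite expf_neq0 ?lt0r_neq0.
  apply: prob_history_le => // w.
  have [Aw|nAw] := pselect (A w); last first.
    rewrite big1 => [|h _].
      by rewrite divr_ge0 ?mulr_ge0 ?exprn_ge0 ?ler0n ?(ltW c0).
    by rewrite indicE memNset// => -[].
  rewrite ler_pdivlMr// mulrC.
  apply: (@le_trans _ _ (#|K|%:R ^+ m * W w [::])); last first.
    by rewrite ler_wpM2l ?exprn_ge0 ?Ww0.
  apply: le_trans (count_hits m (W0 w) (ltW c0) (superW w)).
  rewrite ler_wpM2l ?(ltW c0)//; apply: ler_sum => h _.
  rewrite indicE ler_nat; case: (boolP (w \in B h)) => // /set_mem [_ /= ->] //.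
have EF : E = \bigcup_m F m.
  apply/seteqP; split=> w.
    by move=> [Aw [m cm]]; exists m => //; split=> //; apply/ever_history; exists m.
  by move=> [m _ [Aw /ever_history[j _ cj]]]; split=> //; exists j.
have mF m : measurable (F m) := (PF m).1.
have mE : measurable E by rewrite EF; exact: bigcupT_measurable.
split=> //; rewrite EF.
have ndF : nondecreasing_seq F.
  move=> m n mn; apply/subsetPset => w [Aw /ever_history[j jm cj]]; split => //.
  by apply/ever_history; exists j => //; exact: leq_trans mn.
have mUF : measurable (\bigcup_m F m) by rewrite -EF.
have cF := nondecreasing_cvg_mu (mu := P) mF mUF ndF.
rewrite -(cvg_lim _ cF)//; apply: lime_le; first by apply/cvg_ex; eexists; exact: cF.
by apply: nearW => m; exact: (PF m).2.
Qed.

(** The covers for [eps = 1/(n+1)] intersect in a null set. Covers appear because [Q] itself may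
    fail to be measurable. *)
Lemma ae_of_small (Q : set Omega) :
  (forall eps : R, 0 < eps ->
    exists E, [/\ measurable E, ~` Q `<=` E & (P E <= eps%:E)%E]) ->
  {ae P, forall w, Q w}.
Proof.
move=> H; have n0 (n : nat) : 0 < n.+1%:R^-1 :> R by rewrite invr_gt0.
have [E EP] := choice (fun n => H _ (n0 n)).
have mE : measurable (\bigcap_n E n).
  by apply: bigcapT_measurable => n; have [] := EP n.
exists (\bigcap_n E n); split=> //; last first.
  by move=> w nQ n _; have [_ + _] := EP n; apply.
apply/eqP; rewrite eq_le measure_ge0 andbT.
apply/lee_addgt0Pr => e e0; rewrite add0e.
have [n ne] : exists n : nat, n.+1%:R^-1 < e.
  exists (Num.truncn e^-1); rewrite invf_plt ?posrE//; exact: truncnS_gt.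
have [mEn _ PEn] := EP n.
apply: (@le_trans _ _ (P (E n))); first by apply: le_measure; rewrite ?inE// => w; apply.
by apply: (le_trans PEn); rewrite lee_fin ltW.
Qed.

(** Localizing to the events [W w [::] <= M], which exhaust the space as [M] grows, replaces a bound
    on the expected initial value. *)
Lemma ae_supermartingale_bounded (W : Omega -> seq K -> R) :
  (forall h, measurable_fun setT (W ^~ h : g_sigma_algebraType G -> R)) ->
  (forall w h, 0 <= W w h) ->
  (forall w h, \sum_k W w (k :: h) <= #|K|%:R * W w h) ->
  {ae P, forall w, exists c, forall m, W w (history U m w) < c}.
Proof.
move=> mW W0 superW.
pose Q (M : nat) := [set w | W w [::] <= M%:R ->
  exists c, forall m, W w (history U m w) < c].
have aeQ M : {ae P, forall w, Q M w}.
  apply: ae_of_small => e e0.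
  (* [M+1] instead of [M] keeps the level positive when [M = 0]; the resulting bound is
     [M e / (M+1) <= e]. *)
  have c0 : 0 < (M.+1%:R / e) :> R by rewrite divr_gt0.
  have GA : <<s G >> [set w | W w [::] <= M%:R].
    have := @measurable_fun_le _ (g_sigma_algebraType G) R setT (W ^~ [::]) (cst M%:R).
    by rewrite setTI; apply.
  have [mE PE] := maximal_inequality c0 GA mW W0 superW (fun w Aw => Aw) (ler0n _ _).
  eexists; split; first exact: mE.
    move=> w /= /not_implyP[WM nc]; split=> //.
    apply: contrapT => nm; apply: nc; exists (M.+1%:R / e) => m.
    by rewrite ltNge; apply/negP => h; apply: nm; exists m.
  apply: (le_trans PE); rewrite lee_fin invf_div mulrA ler_pdivrMr// mulrC.
  by rewrite ler_pM2l// ler_nat.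
have : {ae P, forall w, forall M, Q M w} by exact/ae_foralln.
apply: filterS => w /(_ (Num.truncn (W w [::])).+1); apply.
exact/ltW/truncnS_gt.
Qed.

Lemma ae_supermartingale_cvg0 (Z : Omega -> seq K -> R) :
  (forall h, measurable_fun setT (Z ^~ h : g_sigma_algebraType G -> R)) ->
  (forall w h, 0 <= Z w h) ->
  (forall w h, \sum_k Z w (k :: h) <= #|K|%:R * Z w h) ->
  {ae P, forall w, (forall eps, 0 < eps -> exists m, Z w (history U m w) < eps) ->
    (fun m => Z w (history U m w)) @ \oo --> (0 : R)}.
Proof.
move=> mZ Z0 superZ.
pose Q (n : nat) := [set w |
  (forall eps, 0 < eps -> exists m, Z w (history U m w) < eps) ->
   \forall m \near \oo, Z w (history U m w) < n.+1%:R^-1].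
have aeQ n : {ae P, forall w, Q n w}.
  apply: ae_of_small => e e0.
  have c0 : 0 < n.+1%:R^-1 :> R by rewrite invr_gt0.
  (* Chosen so that the restarted process, which starts at most at [a], reaches [1/(n+1)] with
     probability at most [a (n+1) = e]. *)
  pose a : R := e / n.+1%:R.
  have a0 : 0 < a by rewrite divr_gt0.
  pose W w h := if ever (fun h => Z w h < a) h then Z w h else a.
  have GT : <<s G >> [set: Omega] by exact: (@measurableT _ (g_sigma_algebraType G)).
  have mW h : measurable_fun setT (W ^~ h : g_sigma_algebraType G -> R).
    apply: measurable_fun_ifT => //.
    apply: (measurable_fun_bool true); rewrite setTI.
    by apply: ever_measurable => h'; exact: lt_sigma.
  have W0 w h : 0 <= W w h by rewrite /W; case: ifP => // _; exact: ltW.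
  have superW w : forall h, \sum_k W w (k :: h) <= #|K|%:R * W w h.
    exact: restarted_supermartingale.
  have W_init w : setT w -> W w [::] <= a.
    by move=> _; rewrite /W /= orbF; case: ifP => // /ltW.
  have [mE PE] := maximal_inequality c0 GT mW W0 superW W_init (ltW a0).
  eexists; split; first exact: mE.
    move=> w /= /not_implyP[low nQ]; split=> //.
    apply: contrapT => nm; apply: nQ.
    (* From [m0] on the restarted process coincides with [Z], so a later value of [Z] at or above
       [1/(n+1)] lies in the small event. *)
    have [m0 hm0] := low _ a0.
    exists m0 => // m /= m0m; rewrite ltNge; apply/negP => h; apply: nm; exists m.
    rewrite /W; case: ifPn => // /negP[]; apply/ever_history.
    by exists m0.
  by apply: (le_trans PE); rewrite lee_fin /a invrK mulfVK ?lt0r_neq0.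
have : {ae P, forall w, forall n, Q n w} by exact/ae_foralln.
apply: filterS => w HQ low; apply/cvgrPdist_lt => e e0.
have [n ne] : exists n : nat, n.+1%:R^-1 < e.
  exists (Num.truncn e^-1); rewrite invf_plt ?posrE//; exact: truncnS_gt.
have := HQ n low; apply: filterS => m h.
by rewrite sub0r normrN ger0_norm ?Z0//; exact: lt_trans ne.
Qed.

End conditional_counting.

(** * One step of the recursion, averaged over the draw *)

Lemma sqnorm_ge0 (R : realType) (d : nat) (x : 'rV[R]_d) : 0 <= sqnorm x.
Proof. by apply: sumr_ge0 => i _; rewrite -expr2 sqr_ge0. Qed.

Lemma grad_favg (R : realType) (d N : nat) (fk : 'I_N -> 'rV[R]_d -> R) x :
  (forall k x, differentiable (fk k) x) ->
  grad (favg fk) x = N%:R^-1 *: \sum_(k < N) grad (fk k) x.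
Proof.
move=> df; apply/rowP => i; rewrite !mxE summxE.
have -> : favg fk = N%:R^-1 \*: (\sum_(k < N) fk k).
  by apply/funext => y; rewrite /favg /= fct_sumE.
rewrite deriveZ; last by apply: derivable_sum => k; exact: diff_derivable.
rewrite derive_sum; last by move=> k; exact: diff_derivable.
by congr (_ * _); apply: eq_bigr => k _; rewrite mxE.
Qed.

Section one_step.
Context (R : realType) (N d : nat).
Hypothesis N_gt0 : (0 < N)%N.

Definition mean (F : 'I_N -> R) : R := N%:R^-1 * \sum_(k < N) F k.

Lemma meanD (F G : 'I_N -> R) : mean (fun k => F k + G k) = mean F + mean G.
Proof. by rewrite /mean big_split mulrDr. Qed.

Lemma meanZ c (F : 'I_N -> R) : mean (fun k => c * F k) = c * mean F.
Proof. by rewrite /mean -mulr_sumr mulrCA. Qed.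

Lemma meanB (F G : 'I_N -> R) : mean (fun k => F k - G k) = mean F - mean G.
Proof. by rewrite /mean sumrB mulrBr. Qed.

Lemma mean_cst c : mean (fun=> c) = c.
Proof.
rewrite /mean sumr_const card_ord -[c *+ N]mulr_natl mulrA mulVf ?mul1r//.
by rewrite pnatr_eq0 -lt0n.
Qed.

Lemma ler_mean (F G : 'I_N -> R) : (forall k, F k <= G k) -> mean F <= mean G.
Proof. by move=> FG; rewrite ler_wpM2l ?invr_ge0// ler_sum. Qed.

Lemma mean_ge0 (F : 'I_N -> R) : (forall k, 0 <= F k) -> 0 <= mean F.
Proof. by move=> F0; rewrite mulr_ge0 ?invr_ge0// sumr_ge0. Qed.

Lemma eq_mean (F G : 'I_N -> R) : F =1 G -> mean F = mean G.
Proof. by move=> FG; rewrite /mean (eq_bigr _ (fun k _ => FG k)). Qed.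

Lemma mean_sum (F : 'I_d -> 'I_N -> R) :
  mean (fun k => \sum_i F i k) = \sum_i mean (F i).
Proof. by rewrite /mean exchange_big mulr_sumr. Qed.

Lemma mean_sq_center (q : 'I_N -> R) :
  mean (fun k => (q k - mean q) ^+ 2) <= mean (fun k => q k ^+ 2).
Proof.
set m := mean q.
rewrite (@eq_mean _ (fun k => q k ^+ 2 + ((- 2 * m) * q k + m ^+ 2))); last first.
  by move=> k; ring.
rewrite meanD meanD meanZ mean_cst -/m; have := sqr_ge0 m.
by rewrite expr2; lra.
Qed.

(** Each entry is refreshed by exactly one of the [N] draws. This yields the contraction factor
    [1 - 1/N] of the table error. *)
Lemma mean_replace (a b : 'I_N -> R) :
  mean (fun k => mean (fun j => if j == k then b j else a j)) =
  mean a + N%:R^-1 * (mean b - mean a).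
Proof.
rewrite (@eq_mean _ (fun k => mean a + N%:R^-1 * (b k - a k))).
  by rewrite meanD mean_cst meanZ meanB.
move=> k; rewrite /mean (bigD1 k)//= eqxx [in RHS](bigD1 k)//=.
rewrite (eq_bigr a) => [|j /negbTE -> //].
by ring.
Qed.

(** Second moment of one coordinate of the direction, decomposed at the minimizer: [p] is the
    deviation of the fresh gradient, [q] that of the table, [h] the gradient at the minimizer.
    Centring [q] and the factors [lam] and [1 - lam] only lower second moments. *)
Lemma mean_sq_direction (lam : R) (p q h : 'I_N -> R) : 0 <= lam <= 1 ->
  mean (fun k => (p k - lam * (q k - mean q) + (1 - lam) * h k) ^+ 2) <=
  3 * mean (fun k => p k ^+ 2) + 3 * mean (fun k => q k ^+ 2)
    + 3 * mean (fun k => h k ^+ 2).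
Proof.
move=> /andP[l0 l1].
apply: (@le_trans _ _ (mean (fun k =>
    3 * p k ^+ 2 + (3 * (q k - mean q) ^+ 2 + 3 * h k ^+ 2)))).
  apply: ler_mean => k.
  set a := p k; set b := q k - _; set c := h k.
  have H1 : (a - lam * b + (1 - lam) * c) ^+ 2 <=
      3 * a ^+ 2 + 3 * (lam * b) ^+ 2 + 3 * ((1 - lam) * c) ^+ 2.
    set b' := lam * b; set c' := (1 - lam) * c.
    (* These three squares add up to exactly [3 (a^2 + b'^2 + c'^2) - (a - b' + c')^2]. *)
    have := sqr_ge0 (a + b'); have := sqr_ge0 (a - c'); have := sqr_ge0 (b' + c').
    rewrite !expr2; lra.
  have H2 : (lam * b) ^+ 2 <= b ^+ 2.
    by rewrite exprMn ler_piMl ?sqr_ge0// exprn_ile1.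
  have H3 : ((1 - lam) * c) ^+ 2 <= c ^+ 2.
    by rewrite exprMn ler_piMl ?sqr_ge0// exprn_ile1//; lra.
  lra.
rewrite !meanD !meanZ; have := mean_sq_center q; lra.
Qed.

Lemma mean_sqnorm (v : 'I_N -> 'rV[R]_d) :
  mean (fun k => sqnorm (v k)) = \sum_i mean (fun k => v k ord0 i ^+ 2).
Proof.
by rewrite -mean_sum; apply: eq_mean => k; apply: eq_bigr => i _; rewrite expr2.
Qed.

Lemma mean_coord (v : 'I_N -> 'rV[R]_d) i :
  (N%:R^-1 *: \sum_k v k) ord0 i = mean (fun k => v k ord0 i).
Proof. by rewrite mxE summxE. Qed.

Lemma mean_sqnorm_step (lam gam : R) (e : 'rV[R]_d) (G g h : 'I_N -> 'rV[R]_d) :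
  0 <= lam <= 1 -> N%:R^-1 *: \sum_k h k = 0 ->
  mean (fun k => sqnorm
    (e - gam *: (G k - lam *: (g k - N%:R^-1 *: \sum_(k < N) g k)))) <=
  sqnorm e - 2 * gam * dotv e (N%:R^-1 *: \sum_k G k)
  + gam ^+ 2 * (3 * mean (fun k => sqnorm (G k - h k))
    + 3 * mean (fun k => sqnorm (g k - h k)) + 3 * mean (fun k => sqnorm (h k))).
Proof.
move=> l01 h0; rewrite !mean_sqnorm /sqnorm /dotv !mulr_sumr -!big_split/=.
rewrite mulr_sumr -sumrB -big_split/=.
apply: ler_sum => i _.
have mh : mean (fun k => h k ord0 i) = 0 by rewrite -mean_coord h0 mxE.
rewrite mean_coord.
have mY := mean_sq_direction (fun k => (G k - h k) ord0 i)
  (fun k => (g k - h k) ord0 i) (fun k => h k ord0 i) l01.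
set p := fun k => (G k - h k) ord0 i in mY *.
set q := fun k => (g k - h k) ord0 i in mY *.
set c := fun k => h k ord0 i in mY mh *.
pose Y k := p k - lam * (q k - mean q) + (1 - lam) * c k.
have mq : mean q = mean (fun k => g k ord0 i).
  have -> : mean q = mean (fun k => g k ord0 i - c k).
    by apply: eq_mean => k; rewrite /q !mxE.
  by rewrite meanB mh subr0.
rewrite (@eq_mean _ (fun k => e ord0 i ^+ 2 +
  ((- 2 * gam * e ord0 i) * Y k + gam ^+ 2 * Y k ^+ 2))); last first.
  move=> k; have -> : Y k = G k ord0 i - lam * (g k ord0 i - mean (fun k => g k ord0 i)).
    by rewrite /Y mq /p /q /c !mxE; ring.
  rewrite -mean_coord; set gb := N%:R^-1 *: _; rewrite !mxE; ring.
rewrite !meanD !meanZ mean_cst.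
(* Unbiasedness: the correction is centred and [h] averages to zero. *)
have -> : mean Y = mean (fun k => G k ord0 i).
  rewrite /Y meanD meanB !meanZ meanB mean_cst mh.
  rewrite (@eq_mean p (fun k => G k ord0 i - c k)) ?meanB ?mh; first by ring.
  by move=> k; rewrite /p !mxE.
have : gam ^+ 2 * mean (fun k => Y k ^+ 2) <=
    gam ^+ 2 * (3 * mean (fun k => p k ^+ 2) + 3 * mean (fun k => q k ^+ 2)
    + 3 * mean (fun k => c k ^+ 2)) by rewrite ler_wpM2l ?sqr_ge0.
by rewrite expr2; lra.
Qed.

End one_step.

(** * The Lyapunov function and its decrease *)

(** Here [t + g2] and [t] are the tails before and after the step. The factor
    [1 + a g2 <= expR (a g2)] and the term [b g2] are paid for by the shrinking tail; [D] survives
    with coefficient 1 because [expR (a t) >= 1]. *)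
Lemma lyapunov_arith (R : realType) (a b g2 t T T' D : R) :
  0 <= a -> 0 <= b -> 0 <= g2 -> 0 <= t -> 0 <= T -> 0 <= D ->
  T' <= (1 + a * g2) * T + b * g2 - D ->
  expR (a * t) * (T' + b * t) <= expR (a * (t + g2)) * (T + b * (t + g2)) - D.
Proof.
move=> a0 b0 g0 t0 T0 D0 TT'.
have e1 : 1 <= expR (a * t) by rewrite -expR0 ler_expR mulr_ge0.
have e2 : 1 + a * g2 <= expR (a * g2) by exact: expR_ge1Dx.
rewrite (mulrDr a) expRD.
set u := expR (a * t) in e1 *; set v := expR (a * g2) in e2 *.
have Q0 : 0 <= T + b * (t + g2) by rewrite addr_ge0// mulr_ge0// addr_ge0.
apply: (@le_trans _ _ (u * (v * (T + b * (t + g2)) - D))).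
  rewrite ler_pM2l; last lra.
  have : (1 + a * g2) * (T + b * (t + g2)) <= v * (T + b * (t + g2)) by rewrite ler_wpM2r.
  have : 0 <= a * g2 * (b * (t + g2)) by rewrite !mulr_ge0// addr_ge0.
  by rewrite -!mulrA; lra.
have : 0 <= (u - 1) * D by rewrite mulr_ge0// subr_ge0.
lra.
Qed.

Section lyapunov.
Context (R : realType) (N d : nat).
Hypothesis N_gt0 : (0 < N)%N.
Variables (fk : 'I_N -> 'rV[R]_d -> R) (lam : R) (gam : nat -> R).
Variables (xs : 'rV[R]_d) (L s : R).
Hypothesis fk_diff : forall k x, differentiable (fk k) x.
Hypothesis lam01 : 0 <= lam <= 1.
Hypothesis gam_gt0 : forall n, (1 <= n)%N -> 0 < gam n.
Hypothesis gam_noninc : forall n, (1 <= n)%N -> gam n.+1 <= gam n.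
Hypothesis gam_sq : forall n, \sum_(1 <= k < n.+1) gam k ^+ 2 <= s.
Hypothesis grad_xs : grad (favg fk) xs = 0.
Hypothesis monotone : forall x, x != xs -> 0 < dotv (x - xs) (grad (favg fk) x).
Hypothesis L_gt0 : 0 < L.
Hypothesis growth : forall x,
  N%:R^-1 * \sum_(k < N) sqnorm (grad (fk k) x - grad (fk k) xs)
    <= L * sqnorm (x - xs).

Let state : Type := ('rV[R]_d * ('I_N -> 'rV[R]_d))%type.

Definition saga_step (g : R) (z : state) (k : 'I_N) : state :=
  (z.1 - g *: (grad (fk k) z.1 - lam *: (z.2 k - N%:R^-1 *: \sum_(j < N) z.2 j)),
   fun j => if j == k then grad (fk j) z.1 else z.2 j).

Definition table_error (z : state) : R :=
  mean (fun k => sqnorm (z.2 k - grad (fk k) xs)).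

Definition correlation (x : 'rV[R]_d) : R := dotv (x - xs) (grad (favg fk) x).

Definition noise : R := mean (fun k => sqnorm (grad (fk k) xs)).

Definition sq_tail (m : nat) : R := s - \sum_(1 <= k < m.+1) gam k ^+ 2.

(* State [m] is (X_{m+1}, g_{m+1}), hence the step gam_{m+1}. *)
Definition lyapunov (m : nat) (z : state) : R :=
  expR (9 * L * sq_tail m) *
  (sqnorm (z.1 - xs) + 6 * N%:R * gam m.+1 ^+ 2 * table_error z
   + 3 * noise * sq_tail m).

Definition drift (m : nat) (z : state) : R :=
  2 * gam m.+1 * correlation z.1 + 3 * gam m.+1 ^+ 2 * table_error z.

Lemma sq_tail_ge0 m : 0 <= sq_tail m.
Proof. by rewrite subr_ge0. Qed.

Lemma sq_tailS m : sq_tail m = sq_tail m.+1 + gam m.+1 ^+ 2.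
Proof. by rewrite /sq_tail [in RHS]big_nat_recr//= opprD addrA subrK. Qed.

Lemma table_error_ge0 z : 0 <= table_error z.
Proof. by apply: mean_ge0 => k; exact: sqnorm_ge0. Qed.

Lemma noise_ge0 : 0 <= noise.
Proof. by apply: mean_ge0 => k; exact: sqnorm_ge0. Qed.

Lemma correlation_ge0 x : 0 <= correlation x.
Proof.
rewrite /correlation; have [->|/monotone/ltW//] := eqVneq x xs.
by rewrite subrr /dotv big1// => i _; rewrite mxE mul0r.
Qed.

Lemma drift_ge0 m z : 0 <= drift m z.
Proof.
have g0 : 0 <= gam m.+1 by rewrite ltW// gam_gt0.
rewrite /drift addr_ge0//.
  by rewrite mulr_ge0 ?correlation_ge0// mulr_ge0.
by rewrite mulr_ge0 ?table_error_ge0// mulr_ge0 ?sqr_ge0.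
Qed.

Lemma sqnorm_le_lyapunov m z : sqnorm (z.1 - xs) <= lyapunov m z.
Proof.
have V0 := sqnorm_ge0 (z.1 - xs).
have t0 := sq_tail_ge0 m.
have e1 : 1 <= expR (9 * L * sq_tail m) by rewrite -expR0 ler_expR !mulr_ge0// ltW.
have A0 : 0 <= 6 * N%:R * gam m.+1 ^+ 2 * table_error z.
  by rewrite mulr_ge0 ?table_error_ge0// mulr_ge0 ?sqr_ge0// mulr_ge0.
have B0 : 0 <= 3 * noise * sq_tail m by apply: mulr_ge0 t0; apply: mulr_ge0 noise_ge0.
apply: le_trans (ler_peMl _ e1); lra.
Qed.

Lemma lyapunov_ge0 m z : 0 <= lyapunov m z.
Proof. exact: le_trans (sqnorm_ge0 _) (sqnorm_le_lyapunov m z). Qed.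

(** Balance of constants, with [g] the step and [A] the table error: with weight [6 N g^2],
    refreshing one entry removes [6 g^2 A], of which half pays for the variance and half stays in
    the drift. The fresh-gradient term gets [3 + 6 = 9] times [g^2], hence the rate [9 L] by (A3),
    and the noise gets [3 g^2]. *)
Lemma lyapunov_step m z :
  mean (fun k => lyapunov m.+1 (saga_step (gam m.+1) z k)) <= lyapunov m z - drift m z.
Proof.
set g := gam m.+1.
have g0 : 0 < g by exact: gam_gt0.
pose V' k := sqnorm ((saga_step g z k).1 - xs).
pose A' k := table_error (saga_step g z k).
rewrite (@eq_mean _ _ _ (fun k => expR (9 * L * sq_tail m.+1) *
   ((V' k + 6 * N%:R * gam m.+2 ^+ 2 * A' k) + 3 * noise * sq_tail m.+1))) //.
rewrite meanZ meanD meanD meanZ mean_cst// /lyapunov [X in _ <= X - _](_ : _ =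
  expR (9 * L * (sq_tail m.+1 + g ^+ 2)) *
  ((sqnorm (z.1 - xs) + 6 * N%:R * g ^+ 2 * table_error z)
   + 3 * noise * (sq_tail m.+1 + g ^+ 2))); last by rewrite -sq_tailS.
have V0 := sqnorm_ge0 (z.1 - xs); have A0 := table_error_ge0 z.
have N0 : 0 < N%:R :> R by rewrite ltr0n.
have g20 : 0 <= g ^+ 2 by exact: sqr_ge0.
have L0 := ltW L_gt0.
apply: lyapunov_arith; [exact: mulr_ge0|exact: mulr_ge0 noise_ge0|by []| | | |].
- exact: sq_tail_ge0.
- by rewrite addr_ge0// mulr_ge0// mulr_ge0 ?sqr_ge0// mulr_ge0.
- exact: drift_ge0.
set tau := mean (fun k => sqnorm (grad (fk k) z.1 - grad (fk k) xs)).
have tauL : tau <= L * sqnorm (z.1 - xs) by exact: growth.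
have tau0 : 0 <= tau by apply: mean_ge0 => k; exact: sqnorm_ge0.
have mV : mean V' <= sqnorm (z.1 - xs) - 2 * g * correlation z.1 +
    g ^+ 2 * (3 * tau + 3 * table_error z + 3 * noise).
  have gx : N%:R^-1 *: \sum_k grad (fk k) xs = 0 by rewrite -grad_favg.
  rewrite /correlation grad_favg//.
  have := @mean_sqnorm_step _ _ d N_gt0 lam g (z.1 - xs) (fun k => grad (fk k) z.1) z.2
    (fun k => grad (fk k) xs) lam01 gx.
  apply: le_trans.
  by apply: ler_mean => k; rewrite /V' /= addrAC.
have mA : mean A' = table_error z + N%:R^-1 * (tau - table_error z).
  rewrite -(mean_replace N_gt0); apply: eq_mean => k; apply: eq_mean => j /=.
  by case: ifP.
(* Monotone steps let the new weight be replaced by the old one. *)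
have gg : gam m.+2 ^+ 2 <= g ^+ 2.
  by rewrite ler_sqr ?nnegrE ?gam_noninc// ltW// gam_gt0.
have mA0 : 0 <= mean A' by apply: mean_ge0 => k; exact: table_error_ge0.
have h1 : 6 * N%:R * gam m.+2 ^+ 2 * mean A' <= 6 * N%:R * g ^+ 2 * mean A'.
  by rewrite ler_wpM2r// ler_pM2l// mulr_gt0.
have h2 : 6 * N%:R * g ^+ 2 * mean A' =
    6 * N%:R * g ^+ 2 * table_error z + 6 * g ^+ 2 * tau - 6 * g ^+ 2 * table_error z.
  by rewrite mA; field; rewrite lt0r_neq0.
have h3 : g ^+ 2 * tau <= g ^+ 2 * (L * sqnorm (z.1 - xs)) by rewrite ler_wpM2l.
have h4 : 0 <= 9 * L * g ^+ 2 * (6 * N%:R * g ^+ 2 * table_error z).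
  rewrite mulr_ge0//; first by rewrite mulr_ge0// mulr_ge0// ltW.
  by rewrite mulr_ge0// mulr_ge0// mulr_ge0.
rewrite /drift -/g.
lra.
Qed.

End lyapunov.

(** * Pathwise recurrence to the minimizer *)

Lemma dotv_continuous (R : realType) (d : nat) (f g : 'rV[R]_d -> 'rV[R]_d) :
  continuous f -> continuous g -> continuous (fun x => dotv (f x) (g x)).
Proof.
have coord (h : 'rV[R]_d -> 'rV[R]_d) i x :
    {for x, continuous h} -> {for x, continuous (fun y => h y ord0 i)}.
  move=> ch; apply: (@continuous_comp _ _ _ h (fun M => M ord0 i)) => //.
  exact: coord_continuous.
move=> cf cg; apply: continuous_big => [|i _ x]; first exact: add_continuous.
exact (cvgM (coord f i x (cf x)) (coord g i x (cg x))).
Qed.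

Lemma subr_continuous (R : realType) (V : normedModType R) (a : V) :
  continuous (fun x : V => x - a).
Proof.
move=> x; apply: (@cvgB _ _ _ (nbhs x) _ id (cst a)); [exact: cvg_id|exact: cvg_cst].
Qed.

(** The annulus is compact and avoids [xs], so [phi] attains a positive minimum on it; if it is
    empty, [eta = 1] will do. *)
Lemma annulus_lower_bound (R : realType) (d : nat) (xs : 'rV[R]_d)
    (phi : 'rV[R]_d -> R) (r M : R) :
  0 < r -> continuous phi -> (forall x, x != xs -> 0 < phi x) ->
  exists2 eta, 0 < eta &
    forall x, r <= sqnorm (x - xs) <= M -> eta <= phi x.
Proof.
move=> r0 cphi phi0.
pose K : set 'rV[R]_d := [set x | r <= sqnorm (x - xs) <= M].
have csq : continuous (fun x : 'rV[R]_d => sqnorm (x - xs)).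
  have csub : continuous (fun x : 'rV[R]_d => x - xs).
    exact: subr_continuous.
  exact: dotv_continuous.
have Kclosed : closed K.
  rewrite (_ : K = (fun x => sqnorm (x - xs)) @^-1` `[r, M]); last first.
    by apply/seteqP; split=> x; rewrite /K /= in_itv.
  by apply: preimage_closed => //; exact: itv_closed.
have Kbounded : bounded_set K.
  (* A coordinate [t] of [x - xs] has [t^2 <= M], so [2 |t| <= t^2 + 1] gives
     [|t| <= (M + 1) / 2 < M + 2]. *)
  exists (`|xs| + (M + 2)); split; first exact: num_real.
  move=> B /ltW MB x /= /andP[_ xM]; apply: le_trans MB.
  rewrite -[x](subrK xs) addrC; apply: le_trans (ler_normD _ _) _.
  have M0 : 0 <= M by exact: le_trans (sqnorm_ge0 _) xM.
  rewrite lerD2l ltW//; apply/rV_norm_ltP => [|i]; first lra.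
  have : (x - xs) ord0 i ^+ 2 <= sqnorm (x - xs).
    rewrite /sqnorm /dotv (bigD1 i)//= expr2 lerDl.
    by apply: sumr_ge0 => j _; rewrite -expr2 sqr_ge0.
  set t := _ ord0 i => tV; rewrite ltr_norml.
  by have := sqr_ge0 (t - 1); have := sqr_ge0 (t + 1); rewrite !sqrrD1 ?sqrrB1; lra.
have cK : compact K by exact: bounded_closed_compact.
have [K0|/set0P K0] := eqVneq K set0; last first.
  have [|c /set_mem Kc cmin] := compact_EVT_min (f := phi) K0 cK.
    exact: continuous_subspaceT.
  exists (phi c).
    apply: phi0; apply/eqP => cx; move: Kc; rewrite /K /= cx subrr.
    by rewrite /sqnorm /dotv big1 ?leNgt ?r0// => i _; rewrite mxE mul0r.
  by move=> x Kx; apply: cmin; apply/mem_set.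
exists 1 => // x Kx; have : K x by []. 
by rewrite K0.
Qed.

(** A deterministic statement about one path. The bound [K] serves three times: it makes the table
    terms summable, confines the path to a bounded set, and bounds the sum of the late steps. *)
Lemma recurrence (R : realType) (d : nat) (gam : nat -> R) 
    (x : nat -> 'rV[R]_d) xs (phi : 'rV[R]_d -> R) (A t Z : nat -> R)
    (a b c K : R) :
  (forall n, 0 < gam n.+1) ->
  (fun n => \sum_(1 <= k < n.+1) gam k) @ \oo --> +oo ->
  t @ \oo --> 0 -> (forall n, 0 <= t n) ->
  continuous phi -> (forall x, x != xs -> 0 < phi x) -> phi xs = 0 ->
  (forall n, 0 <= A n) -> 0 <= a -> 0 <= b -> 0 <= c ->
  (forall n, sqnorm (x n - xs) <= Z n) ->
  (forall n, Z n <= expR (a * t n) *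
     (sqnorm (x n - xs) + c * gam n.+1 ^+ 2 * A n + b * t n)) ->
  (forall n, Z n + \sum_(0 <= j < n)
     (2 * gam j.+1 * phi (x j) + 3 * gam j.+1 ^+ 2 * A j) <= K) ->
  forall eps, 0 < eps -> exists n, Z n < eps.
Proof.
move=> gam0 gamoo t0 tge0 cphi phi0 phixs A0 a0 b0 c0 VZ ZV ZK eps eps0.
apply: contrapT => nZ.
have {nZ} Zeps n : eps <= Z n by rewrite leNgt; apply/negP => h; apply: nZ; exists n.
have phige0 y : 0 <= phi y by have [->|/phi0/ltW//] := eqVneq y xs; rewrite phixs.
have V0 n := sqnorm_ge0 (x n - xs).
have Z0 n : 0 <= Z n := le_trans (V0 n) (VZ n).
have q0 n : 0 <= gam n.+1 ^+ 2 * A n by rewrite mulr_ge0 ?sqr_ge0.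
pose S n := \sum_(0 <= j < n) gam j.+1 ^+ 2 * A j.
have SK n : S n <= K.
  apply: le_trans (ZK n); apply: (@le_trans _ _ (\sum_(0 <= j < n)
     (2 * gam j.+1 * phi (x j) + 3 * gam j.+1 ^+ 2 * A j))); last by rewrite lerDr.
  apply: ler_sum => j _.
  have : 0 <= gam j.+1 * phi (x j) by rewrite mulr_ge0// ltW.
  by have := q0 j; lra.
(* The drift also controls the table term, so that Z is small as soon as
   |x - xs| is. *)
have cS : cvgn (series (fun n => gam n.+1 ^+ 2 * A n)).
  apply: nondecreasing_is_cvgn.
    by apply/nondecreasing_seqP => n; rewrite seriesEnat /= big_nat_recr//= lerDl.
  by exists K => _ [n _ <-]; rewrite seriesEnat; exact: SK.
have q_0 : (fun n => gam n.+1 ^+ 2 * A n) @ \oo --> 0 := cvg_series_cvg_0 cS.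
pose u n := expR (a * t n).
have u1 : u @ \oo --> (1 : R).
  rewrite -[X in _ --> X]expR0; apply: continuous_cvg; first exact: continuous_expR.
  by rewrite -[X in _ --> X](mulr0 a); apply: cvgMl_tmp.
have w0 : (fun n => u n * (c * (gam n.+1 ^+ 2 * A n) + b * t n)) @ \oo --> (0 : R).
  rewrite -[X in _ --> X](mulr0 1); apply: cvgM => //.
  rewrite -[X in _ --> X](addr0 0); apply: cvgD.
    by rewrite -[X in _ --> X](mulr0 c); apply: cvgMl_tmp.
  by rewrite -[X in _ --> X](mulr0 b); apply: cvgMl_tmp.
(* Hence the path is eventually away from xs, where phi is bounded below. *)
have [n0 hn0] : exists n0, forall n, (n0 <= n)%N -> eps / 4 <= sqnorm (x n - xs).
  have near1 : \forall n \near \oo, u n < 2 by apply: (cvgr_lt (1 : R)) => //; rewrite ltr1n.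
  have near2 : \forall n \near \oo, u n * (c * (gam n.+1 ^+ 2 * A n) + b * t n) < eps / 2.
    by apply: (cvgr_lt (0 : R)) => //; rewrite divr_gt0.
  have [n0 _ hn0] : \forall n \near \oo, eps / 4 <= sqnorm (x n - xs).
    near=> n.
    have h1 : u n < 2 by near: n.
    have h2 : u n * (c * (gam n.+1 ^+ 2 * A n) + b * t n) < eps / 2 by near: n.
    (* With [V] the squared distance, [eps <= u V + w], [u < 2] and [w < eps / 2] leave
       [V > eps / 4]. *)
    have := Zeps n; have := ZV n; rewrite -/(u n).
    have : u n * sqnorm (x n - xs) <= 2 * sqnorm (x n - xs) by rewrite ler_wpM2r// ltW.
    rewrite -!mulrA -addrA mulrDr; lra.
  by exists n0.
have [|eta eta0 heta] := @annulus_lower_bound R d xs phi (eps / 4) K _ cphi phi0.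
  by rewrite divr_gt0.
have VK n : sqnorm (x n - xs) <= K.
  apply: le_trans (VZ n) _; apply: le_trans (ZK n); rewrite lerDl.
  apply: sumr_ge0 => j _; have : 0 <= gam j.+1 * phi (x j) by rewrite mulr_ge0// ltW.
  by have := q0 j; lra.
have bound n : 2 * eta * \sum_(n0 <= j < n0 + n) gam j.+1 <= K.
  apply: le_trans (ZK (n0 + n)%N).
  rewrite mulr_sumr [in leRHS](big_cat_nat (n := n0)) ?leq_addr//=.
  have h1 : 0 <= \sum_(0 <= j < n0) (2 * gam j.+1 * phi (x j) + 3 * gam j.+1 ^+ 2 * A j).
    apply: sumr_ge0 => j _; have : 0 <= gam j.+1 * phi (x j) by rewrite mulr_ge0// ltW.
    by have := q0 j; lra.
  have h2 : \sum_(n0 <= j < n0 + n) 2 * eta * gam j.+1 <=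
      \sum_(n0 <= j < n0 + n) (2 * gam j.+1 * phi (x j) + 3 * gam j.+1 ^+ 2 * A j).
    apply: ler_sum_nat => j /andP[nj _].
    have : eta * gam j.+1 <= phi (x j) * gam j.+1.
      by rewrite ler_pM2r// heta// VK hn0.
    by have := q0 j; lra.
  by have := Z0 (n0 + n)%N; lra.
(* At this level the steps beyond [n0] sum to more than [K / (2 eta)], against [bound]. *)
have /cvgryPge /(_ (\sum_(1 <= k < n0.+1) gam k + K / (2 * eta) + 1))
  [n1 _ /(_ (n0 + n1)%N)] := gamoo.
rewrite /= leq_addl => /(_ isT).
rewrite [in leRHS](big_cat_nat (n := n0.+1)) ?ltnS ?leq_addr//= -addrA lerD2l.
rewrite big_add1 /= => h.
have := bound n1; rewrite mulrC -ler_pdivlMr ?mulr_gt0//; lra.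
Unshelve. all: by end_near.
Qed.

(** * The algorithm on words and its measurability *)

(** Making the draws an explicit argument separates them from the initial state and allows summation
    over them. The length of the past determines the step size. *)
Fixpoint saga_word (R : realType) (N d : nat) (fk : 'I_N -> 'rV[R]_d -> R) (lam : R)
    (gam : nat -> R) (z : 'rV[R]_d * ('I_N -> 'rV[R]_d)) (h : seq 'I_N) :=
  if h is k :: h' then
    saga_step fk lam (gam (size h').+1) (saga_word fk lam gam z h') k
  else z.

Lemma saga_state_history (R : realType) (N d : nat) (fk : 'I_N -> 'rV[R]_d -> R)
    (lam : R) (gam : nat -> R) (T : Type) (U : nat -> T -> 'I_N) (w : T) x0 x1 m :
  saga_state fk lam gam x0 x1 (fun n => U n w) m =
  saga_word fk lam gam (x1, fun k => grad (fk k) x0) (history U m w).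
Proof. by elim: m => //= m ->; rewrite size_history. Qed.

Lemma measurable_dotv (R : realType) (d0 : measure_display) (T : measurableType d0)
    (d : nat) (Y Z : T -> 'rV[R]_d) :
  (forall i, measurable_fun setT (fun w => Y w ord0 i)) ->
  (forall i, measurable_fun setT (fun w => Z w ord0 i)) ->
  measurable_fun setT (fun w => dotv (Y w) (Z w)).
Proof. by move=> mY mZ; apply: measurable_sum => i; exact: measurable_funM. Qed.

Section saga_measurability.
Context (R : realType) (d0 : measure_display) (T : measurableType d0) (N d : nat).
Variables (fk : 'I_N -> 'rV[R]_d -> R) (lam : R) (gam : nat -> R).
Hypothesis fk_diff : forall k x, differentiable (fk k) x.
Variables (X0 X1 : T -> 'rV[R]_d).
Hypothesis mX0 : forall i, measurable_fun setT (fun w => X0 w ord0 i).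
Hypothesis mX1 : forall i, measurable_fun setT (fun w => X1 w ord0 i).

Let z w h := saga_word fk lam gam (X1 w, fun k => grad (fk k) (X0 w)) h.

(** For a fixed word the state is a function of the initial vectors alone; [T] will be the sample
    space with the sigma-algebra they generate. *)
Lemma saga_word_measurable h :
  (forall i, measurable_fun setT (fun w => (z w h).1 ord0 i)) /\
  (forall k i, measurable_fun setT (fun w => (z w h).2 k ord0 i)).
Proof.
elim: h => [|k h [IH1 IH2]] /=.
  by split=> [//|k i]; exact: grad_measurable_comp.
split=> [i|j i] /=; last first.
  by case: (j == k); [exact: grad_measurable_comp|exact: IH2].
rewrite (_ : (fun w => _) = fun w => (z w h).1 ord0 i - gam (size h).+1 *
    (grad (fk k) (z w h).1 ord0 i - lam *
      ((z w h).2 k ord0 i - N%:R^-1 * \sum_j (z w h).2 j ord0 i))); last first.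
  by apply/funext => w; rewrite -summxE !mxE.
apply: measurable_funB => //; apply: measurable_funM => //.
apply: measurable_funB; first exact: grad_measurable_comp.
apply: measurable_funM => //; apply: measurable_funB => //.
by apply: measurable_funM => //; exact: measurable_sum.
Qed.

Variables (xs : 'rV[R]_d) (L s : R).

Lemma table_error_measurable h : measurable_fun setT (fun w => table_error fk xs (z w h)).
Proof.
have [_ m2] := saga_word_measurable h.
apply: measurable_funM => //; apply: measurable_sum => k.
by apply: measurable_dotv => i; under eq_fun do rewrite !mxE; apply: measurable_funB.
Qed.

Lemma lyapunov_measurable h :
  measurable_fun setT (fun w => lyapunov fk gam xs L s (size h) (z w h)).
Proof.
have [m1 _] := saga_word_measurable h.
apply: measurable_funM => //; apply: measurable_funD => //; apply: measurable_funD.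
  by apply: measurable_dotv => i; under eq_fun do rewrite !mxE; apply: measurable_funB.
by apply: measurable_funM => //; exact: table_error_measurable.
Qed.

Lemma drift_measurable h :
  measurable_fun setT (fun w => drift fk gam xs (size h) (z w h)).
Proof.
have [m1 _] := saga_word_measurable h.
apply: measurable_funD; apply: measurable_funM => //; last exact: table_error_measurable.
apply: measurable_dotv => i.
  by under eq_fun do rewrite !mxE; apply: measurable_funB.
under eq_fun do rewrite grad_favg// mxE summxE.
by apply: measurable_funM => //; apply: measurable_sum => k; exact: grad_measurable_comp.
Qed.

Lemma past_drift_measurable h :
  measurable_fun setT (fun w => past_sum (fun h => drift fk gam xs (size h) (z w h)) h).
Proof.
elim: h => //= k h IH; apply: measurable_funD => //; exact: drift_measurable.
Qed.

End saga_measurability.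

(** * Almost sure convergence *)

Lemma past_sum_history (V : nmodType) (K : finType) (T : Type) (U : nat -> T -> K)
    (f : seq K -> V) m w :
  past_sum f (history U m w) = \sum_(0 <= j < m) f (history U j w).
Proof.
elim: m => [|m IH]; first by rewrite big_geq.
by rewrite big_nat_recr//= IH.
Qed.

Lemma sqnorm_cvg0 (R : realType) (d : nat) (x : nat -> 'rV[R]_d) (xs : 'rV[R]_d) :
  (fun n => sqnorm (x n - xs)) @ \oo --> (0 : R) -> x @ \oo --> xs.
Proof.
move=> V0; apply/cvgrPdist_lt => e e0.
have e20 : 0 < e ^+ 2 by rewrite exprn_gt0.
have : \forall n \near \oo, sqnorm (x n - xs) < e ^+ 2.
  exact: (cvgr_lt (0 : R)).
apply: filterS => n h; rewrite distrC; apply/rV_norm_ltP => // i.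
rewrite -(@ltr_pXn2r _ 2)// ?nnegrE ?(ltW e0)// real_normK ?num_real//.
apply: le_lt_trans h; rewrite /sqnorm /dotv (bigD1 i)//= expr2 lerDl.
by apply: sumr_ge0 => j _; rewrite -expr2 sqr_ge0.
Qed.

Theorem theorem1 (R : realType) (d0 : measure_display) (Omega : measurableType d0)
  (P : probability Omega R) (N d : nat)
  (fk : 'I_N -> 'rV[R]_d -> R) (lam : R) (gam : nat -> R)
  (X0 X1 : Omega -> 'rV[R]_d) (U : nat -> Omega -> 'I_N) (xstar : 'rV[R]_d) :
  (0 < N)%N -> (0 < d)%N ->
  (* each f_k differentiable *)
  (forall k x, differentiable (fk k) x) ->
  (* lambda in [0,1] *)
  0 <= lam <= 1 ->
  (* steps: positive, nonincreasing, to 0, sum = +oo, sum of squares < +oo *)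
  (forall n, (1 <= n)%N -> 0 < gam n) ->
  (forall n, (1 <= n)%N -> gam n.+1 <= gam n) ->
  gam @ \oo --> 0 ->
  (fun n => \sum_(1 <= k < n.+1) gam k) @ \oo --> +oo ->
  cvg ((fun n => \sum_(1 <= k < n.+1) gam k ^+ 2) @ \oo) ->
  (* X_0, X_1 square-integrable random vectors *)
  (forall i (B : set R), measurable B ->
     measurable ((fun w => X0 w ord0 i) @^-1` B) /\
     measurable ((fun w => X1 w ord0 i) @^-1` B)) ->
  (forall i, P.-integrable setT (fun w => ((X0 w ord0 i) ^+ 2)%:E) /\
             P.-integrable setT (fun w => ((X1 w ord0 i) ^+ 2)%:E)) ->
  (* (U_n)_{n>=2} i.i.d. uniform on {1..N}, independent of (X_0, X_1) *)
  (forall n (S : {set 'I_N}), measurable [set w | U n w \in S]) ->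
  (forall n k, (2 <= n)%N -> P [set w | U n w = k] = (N%:R^-1)%:E) ->
  saga_indep P X0 X1 U ->
  (* (A1) *)
  (forall x, differentiable (favg fk) x) ->
  continuous (grad (favg fk)) ->
  grad (favg fk) xstar = 0 ->
  (forall x, grad (favg fk) x = 0 -> x = xstar) ->
  (* (A2) *)
  (forall x, x != xstar -> 0 < dotv (x - xstar) (grad (favg fk) x)) ->
  (* (A3) *)
  (exists L : R, 0 < L /\ forall x,
     N%:R^-1 * \sum_(k < N) sqnorm (grad (fk k) x - grad (fk k) xstar)
       <= L * sqnorm (x - xstar)) ->
  {ae P, forall w,
     (fun n => saga_iter fk lam gam (X0 w) (X1 w) (fun n => U n w) n)
       @ \oo --> xstar} /\
  {ae P, forall w,
     (fun n => favg fk (saga_iter fk lam gam (X0 w) (X1 w) (fun n => U n w) n))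
       @ \oo --> favg fk xstar}.
Proof.
move=> N0 _ df lam01 gam0 gamS _ gamoo gam2 mX _ mU uU indep dfavg cgrad gradxs _ mono
  [L [L0 growth]].
set s : R := lim ((fun n => \sum_(1 <= k < n.+1) gam k ^+ 2) @ \oo).
have gam_sq n : \sum_(1 <= k < n.+1) gam k ^+ 2 <= s.
  apply: (nondecreasing_cvgn_le _ gam2); apply/nondecreasing_seqP => m.
  by rewrite [leRHS]big_nat_recr//= lerDl sqr_ge0.
have tail0 : sq_tail gam s @ \oo --> (0 : R).
  rewrite -(subrr s); apply: cvgB; [exact: cvg_cst|exact: gam2].
(* The generators in [sigma_pair], so that [indep] applies to [<<s G >>] as it stands. *)
pose G := [set A | exists i : 'I_d, exists B : set R, measurable B /\
        (A = (fun w => X0 w ord0 i) @^-1` B \/ A = (fun w => X1 w ord0 i) @^-1` B)].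
have Gm : <<s G >> `<=` measurable.
  apply: smallest_sub; first exact: sigma_algebra_measurable.
  by move=> _ [i [B [mB [->|->]]]]; have [] := mX i B mB.
pose T := g_sigma_algebraType G.
have mX0 i : measurable_fun setT (fun w : T => X0 w ord0 i).
  by move=> _ B mB; rewrite setTI; apply: sub_sigma_algebra;
    exists i, B; split=> //; left.
have mX1 i : measurable_fun setT (fun w : T => X1 w ord0 i).
  by move=> _ B mB; rewrite setTI; apply: sub_sigma_algebra;
    exists i, B; split=> //; right.
pose z w h := saga_word fk lam gam (X1 w, fun k => grad (fk k) (X0 w)) h.
pose Z w h := lyapunov fk gam xstar L s (size h) (z w h).
pose D w h := drift fk gam xstar (size h) (z w h).
have Z0 w h : 0 <= Z w h by exact: lyapunov_ge0.
have D0 w h : 0 <= D w h by exact: drift_ge0.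
have stepZ w h : \sum_k Z w (k :: h) <= #|'I_N|%:R * (Z w h - D w h).
  rewrite card_ord mulrC -ler_pdivrMr ?ltr0n// mulrC.
  exact: lyapunov_step.
have superZ w h : \sum_k Z w (k :: h) <= #|'I_N|%:R * Z w h.
  by apply: le_trans (stepZ w h) _; rewrite ler_wpM2l// lerBlDr lerDl.
have N0' : (0 < #|'I_N|)%N by rewrite card_ord.
have uU' n k : (2 <= n)%N -> P [set w | U n w = k] = (#|'I_N|%:R^-1)%:E.
  by rewrite card_ord; exact: uU.
have mZ h : measurable_fun setT (Z ^~ h : T -> R) by exact: lyapunov_measurable.
pose W w h := Z w h + past_sum (D w) h.
have mW h : measurable_fun setT (W ^~ h : T -> R).
  by apply: measurable_funD; [exact: mZ|exact: past_drift_measurable].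
have W0 w h : 0 <= W w h by rewrite addr_ge0// past_sum_ge0.
have superW w h : \sum_k W w (k :: h) <= #|'I_N|%:R * W w h.
  exact: compensated_supermartingale.
have bounded := ae_supermartingale_bounded Gm N0' mU uU' indep mW W0 superW.
have vanish := ae_supermartingale_cvg0 Gm N0' mU uU' indep mZ Z0 superZ.
have iter_cvg : {ae P, forall w,
    (fun n => saga_iter fk lam gam (X0 w) (X1 w) (fun n => U n w) n) @ \oo --> xstar}.
  move: bounded vanish; apply: filterS2 => w [K HK] HZ.
  (* State [n] holds the iterate of index [n+1], and a shift does not affect the limit. *)
  suff : (fun n => saga_iter fk lam gam (X0 w) (X1 w) (fun n => U n w) n.+1)
      @ \oo --> xstar.
    by rewrite cvg_shiftS.
  rewrite /=; under eq_fun do rewrite saga_state_history.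
  apply: sqnorm_cvg0.
  have VZ n : sqnorm ((z w (history U n w)).1 - xstar) <= Z w (history U n w).
    exact: sqnorm_le_lyapunov.
  (* The squared distance lies between 0 and [Z]; it remains to see that [Z] gets arbitrarily small
     along the path, which [recurrence] provides. *)
  apply: (squeeze_cvgr _ (cvg_cst (0 : R)) (HZ _)).
    by apply: nearW => n; rewrite sqnorm_ge0 VZ.
  apply: (@recurrence _ _ gam (fun n => (z w (history U n w)).1) xstar
    (correlation fk xstar) (fun n => table_error fk xstar (z w (history U n w)))
    (sq_tail gam s) _ (9 * L) (3 * noise fk xstar) (6 * N%:R) K) => //.
  - by move=> n; exact: gam0.
  - exact: sq_tail_ge0.
  - by apply: dotv_continuous => //; exact: subr_continuous.
  - by rewrite /correlation subrr /dotv big1// => i _; rewrite mxE mul0r.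
  - by move=> n; exact: table_error_ge0.
  - by rewrite mulr_ge0// ltW.
  - by rewrite mulr_ge0// noise_ge0.
  - by move=> n; rewrite /Z /lyapunov size_history.
  - move=> n; apply: le_trans (ltW (HK n)); rewrite /W past_sum_history.
    by under [in leRHS]eq_bigr do rewrite /D size_history.
split=> //; move: iter_cvg; apply: filterS => w hw; apply: continuous_cvg => //.
exact: differentiable_continuous.
Qed.
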